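(* For every $n\ge 2$, $FlDr_n^{3M}=FlDr_n$. That is, a point $P\in \mathbb{TP}^{\binom n1-1}\times\cdots\times\mathbb{TP}^{\binom n{n-1}-1}$ is a solution of the tropicalization of every incidence-Plücker relation if and only if it is a solution of the tropicalization of every three-term incidence-Plücker relation and its support forms a flag matroid.
   Context: Let $[n]=\{1,\dots,n\}$; variables $P_I$ are indexed by subsets $I\subset[n]$ with $1\le|I|\le n-1$. Incidence-Plücker relations: for $1\le r\le s\le n$, $I\subset[n]$ with $|I|=r-1$ and $J\subset[n]$ with $|J|=s+1$, the incidence-Plücker relation is $\sum_{j\in J\setminus I}\mathrm{sign}(j,I,J)\,P_{I\cup\{j\}}P_{J\setminus\{j\}}$, where $\mathrm{sign}(j,I,J)=(-1)^{|\{k\in J:\,k<j\}|+|\{i\in I:\,j<i\}|}$. $\mathfrak P_{IP;n}$ is the set of all of them; $\mathfrak P^{3\text{ term}}_{IP;n}$ the set of those with exactly three terms (i.e. $|J\setminus I|=3$). Tropical notions: $\mathbb T=\mathbb R\cup\{\infty\}$; $\mathbb{TP}^{m-1}=(\mathbb T^m\setminus\{(\infty,\dots,\infty)\})/\sim$ with $x\sim y$ iff $x=y+(c,\dots,c)$, $c\in\mathbb R$; the $k$-th factor of the product has coordinates indexed by $k$-subsets of $[n]$. For a polynomial $p=\sum_b c_bx^b$ with real coefficients (distinct exponents $b$, all $c_b\neq0$), the value of the term $c_bx^b$ at $y$ is $b\cdot y$ (with $0\cdot\infty=0$); $y$ is a solution of the tropicalization of $p$ if the minimum term value is attained by at least two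 terms. $\overline{\mathrm{trop}}(\mathcal P)$ is the set of points solving the tropicalizations of all $p\in\mathcal P$. The complete flag Dressian is $FlDr_n=\overline{\mathrm{trop}}(\mathfrak P_{IP;n})$. The support of $P$ is $\{I:P_I\ne\infty\}$. A (complete) flag matroid on $[n]$ is a sequence $(\mathcal M_1,\dots,\mathcal M_{n-1})$ of matroids on $[n]$, $\mathrm{rank}\,\mathcal M_i=i$, such that for all $j<k$ every basis of $\mathcal M_j$ is contained in some basis of $\mathcal M_k$ and every basis of $\mathcal M_k$ contains some basis of $\mathcal M_j$; the support forms a flag matroid if its $k$-element members are the bases of $\mathcal M_k$ for such a flag matroid. $FlDr_n^{3M}$ is the set of points of $\overline{\mathrm{trop}}(\mathfrak P^{3\text{ term}}_{IP;n})$ whose support forms a flag matroid. *)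

(* Defs.v *)
From HB Require Import structures.
From mathcomp Require Import all_boot all_order all_algebra.
From mathcomp Require Import reals.
From mathcomp Require Import mpoly.

Set Implicit Arguments.
Unset Strict Implicit.
Unset Printing Implicit Defensive.

Import Order.TTheory GRing.Theory Num.Theory.
Local Open Scope ring_scope.

(* Tropical numbers T = R u {oo}, encoded as option R (None = oo).     *)

Section Tropical.
Variable R : realType.

Definition trop := option R.

Definition tle (a b : trop) : bool :=
  match a, b with
  | _, None => true
  | None, Some _ => false
  | Some x, Some y => (x <= y)%R
  end.

(* value b . y of the term c_b x^b at y (with 0 * oo = 0) *)
Definition mono_val (N : nat) (b : 'X_{1..N}) (y : 'I_N -> trop) : trop :=
  if [exists i : 'I_N, (0 < b i)%N && (y i == None)] then None
  else Some (\sum_(i < N) (b i)%:R * odflt 0 (y i)).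

(* y solves the tropicalization of p : the minimum term value is attained
   by at least two (distinct) terms of p.  The zero polynomial (no terms)
   is regarded as imposing no condition. *)
Definition trop_sol (N : nat) (p : {mpoly R[N]}) (y : 'I_N -> trop) : Prop :=
  p = 0 \/
  exists b1 b2 : 'X_{1..N},
    [/\ b1 \in msupp p, b2 \in msupp p, b1 != b2 &
        forall b, b \in msupp p ->
          tle (mono_val b1 y) (mono_val b y) && tle (mono_val b2 y) (mono_val b y)].

End Tropical.

Section IP.
Variable R : realType.
Variable n : nat.

Definition nvars : nat := #|{set 'I_n}|.

Definition PX (A : {set 'I_n}) : {mpoly R[nvars]} := 'X_(enum_rank A).

Definition ip_sign (j : 'I_n) (I J : {set 'I_n}) : R :=
  (-1) ^+ (#|[set k in J | (k < j)%N]| + #|[set i in I | (j < i)%N]|).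

Definition ip_rel (I J : {set 'I_n}) : {mpoly R[nvars]} :=
  \sum_(j in J :\: I) ip_sign j I J *: (PX (j |: I) * PX (J :\ j)).

Definition ip_index (I J : {set 'I_n}) : Prop :=
  exists r s : nat,
    [/\ (1 <= r)%N, (r <= s)%N, (s <= n)%N, #|I| = r.-1 & #|J| = s.+1].

Definition pt_val (P : {set 'I_n} -> trop R) : 'I_nvars -> trop R :=
  fun i => P (enum_val i).

(* P is (a representative of) a point of TP^{C(n,1)-1} x ... x TP^{C(n,n-1)-1}:
   no factor is identically oo.  (Values of P on sets of size 0 or n are
   not coordinates and are never used.) *)
Definition in_flag_tproj (P : {set 'I_n} -> trop R) : Prop :=
  forall k : nat, (1 <= k <= n.-1)%N ->
    exists A : {set 'I_n}, #|A| = k /\ P A <> None.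

Definition in_FlDr (P : {set 'I_n} -> trop R) : Prop :=
  forall I J : {set 'I_n}, ip_index I J -> trop_sol (ip_rel I J) (pt_val P).

Definition in_trop_IP3 (P : {set 'I_n} -> trop R) : Prop :=
  forall I J : {set 'I_n}, ip_index I J -> #|J :\: I| = 3%N ->
    trop_sol (ip_rel I J) (pt_val P).

End IP.

Section Matroid.
Variable n : nat.

Definition matroid_bases (B : {set {set 'I_n}}) : Prop :=
  B != set0 /\
  forall B1 B2, B1 \in B -> B2 \in B -> forall x, x \in B1 :\: B2 ->
    exists2 y, y \in B2 :\: B1 & (y |: (B1 :\ x)) \in B.

Definition matroid_rank_bases (k : nat) (B : {set {set 'I_n}}) : Prop :=
  matroid_bases B /\ forall A, A \in B -> #|A| = k.

Definition flag_matroid (M : nat -> {set {set 'I_n}}) : Prop :=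
  (forall k, (1 <= k <= n.-1)%N -> matroid_rank_bases k (M k)) /\
  (forall j k, (1 <= j)%N -> (j < k)%N -> (k <= n.-1)%N ->
     (forall Bj, Bj \in M j -> exists2 Bk, Bk \in M k & Bj \subset Bk) /\
     (forall Bk, Bk \in M k -> exists2 Bj, Bj \in M j & Bj \subset Bk)).

End Matroid.

Section Support.
Variable R : realType.
Variable n : nat.

Definition supp_k (P : {set 'I_n} -> trop R) (k : nat) : {set {set 'I_n}} :=
  [set A : {set 'I_n} | (#|A| == k) && (P A != None)].

Definition support_flag_matroid (P : {set 'I_n} -> trop R) : Prop :=
  flag_matroid (supp_k P).

Definition in_FlDr3M (P : {set 'I_n} -> trop R) : Prop :=
  in_trop_IP3 P /\ support_flag_matroid P.

End Support.

(* Main.v *)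
Require Import Defs.
From HB Require Import structures.
From mathcomp Require Import all_boot all_order all_algebra.
From mathcomp Require Import reals.
From mathcomp Require Import mpoly.
From mathcomp Require Import lra zify.

(** Writing [w] for the finite values of [P], a point solves the relation of
   [I] and [J] iff every finite term [w (j |: I) + w (J :\ j)] is matched by
   another one that is not larger; so the tropical relations are exchange
   properties. They give the matroid exchange axiom, and the containments of
   bases by exchanging until the distance between two bases is zero.

   Conversely, for [#|J| = #|I| + 2] the relations follow from the three-term
   ones by Murota's local-to-global theorem for valuated matroids. For
   [#|J| = #|I| + 3] the same theorem is applied to the elementary lift of two
   consecutive layers, whose support is a matroid: containment of bases is weaker
   than being a matroid quotient, but the three-term incidence relations make up
   for the difference. Larger gaps are reached by induction, as inclusion of
   tropical linear spaces is transitive. *)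

Set Implicit Arguments.
Unset Strict Implicit.
Unset Printing Implicit Defensive.
Import Order.TTheory GRing.Theory Num.Theory.
Local Open Scope ring_scope.

(** * Valuated matroids *)

Lemma mem_notin_neq (T : finType) (A : {set T}) x y :
  x \in A -> y \notin A -> (x == y = false) * (y == x = false).
Proof.
by move=> xA; rewrite (eq_sym y); have [<-|//] := eqVneq x y; rewrite xA.
Qed.

Ltac memb :=
  repeat match goal with
  | H : is_true (_ && _) |- _ => case/andP: H => ? ?
  | H : is_true ?b |- context [?b] => rewrite H
  | H : is_true (~~ ?b) |- context [?b] => rewrite (negbTE H)
  | H : is_true (~~ (?a == ?b)) |- context [?b == ?a] =>
      rewrite (eq_sym b a) (negbTE H)
  | H : is_true (?a \in ?A), H' : is_true (?b \notin ?A) |- context [?a == ?b] =>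
      rewrite (mem_notin_neq H H')
  | H : is_true (?a \in ?A), H' : is_true (?b \notin ?A) |- context [?b == ?a] =>
      rewrite (mem_notin_neq H H')
  | |- context [?a == ?a] => rewrite eqxx
  end; rewrite ?andbF ?orbT //=.

Ltac split_at z :=
  repeat match goal with
  | |- context [z == ?a] =>
      let E := fresh "E" in case: (eqVneq z a) => [->|E]; memb
  end.

(** Compares memberships pointwise, after deciding whether the point is one of the named elements;
    the facts needed on distinctness and membership must be in the context. *)
Ltac set_eq :=
  let z := fresh "z" in apply/setP => z; rewrite ?inE; split_at z; memb;
  repeat match goal with |- context [z \in ?A] => case: (z \in A) end.

Section ValuatedExchange.
Variables (T : finType) (R : realFieldType).
Variables (B : pred {set T}) (w : {set T} -> R).

Definition exchange :=
  forall X Y, B X -> B Y -> forall x, x \in X :\: Y ->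
    exists2 y, y \in Y :\: X & B (y |: (X :\ x)).

(** [B] and [w] together encode a function to $\mathbb R\cup\{\infty\}$ that is finite exactly on
    [B], with the minimum convention. *)
Definition dominates X' Y' X Y := [/\ B X', B Y' & w X' + w Y' <= w X + w Y].

(** The tropical three-term Plücker relation: among the pairings [ab|cd], [ac|bd], [ad|bc], none is
    the strict minimum. *)
Definition three_term :=
  forall (I : {set T}) a b c d, uniq [:: a; b; c; d] ->
    a \notin I -> b \notin I -> c \notin I -> d \notin I ->
    let X := a |: (b |: I) in let Y := c |: (d |: I) in
    B X -> B Y ->
    dominates (a |: (c |: I)) (b |: (d |: I)) X Y \/
    dominates (a |: (d |: I)) (b |: (c |: I)) X Y.

(** The Dress-Wenzel axiom of valuated matroids, for minima. *)
Definition valuated_exchange :=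
  forall X Y, B X -> B Y -> forall x, x \in X :\: Y ->
    exists2 y, y \in Y :\: X & dominates (y |: (X :\ x)) (x |: (Y :\ y)) X Y.

Variable k : nat.
Hypothesis cardB : forall X, B X -> #|X| = k.
Hypothesis exB : exchange.

Lemma card_setDC X Y : B X -> B Y -> #|X :\: Y| = #|Y :\: X|.
Proof.
move=> /cardB cX /cardB cY.
by have := cardsID Y X; have := cardsID X Y; rewrite setIC; lia.
Qed.

Lemma card_swapD (X Y : {set T}) x y : x \in X :\: Y -> y \in Y :\: X ->
  (#|(y |: (X :\ x)) :\: Y|.+1 = #|X :\: Y|)%N.
Proof.
rewrite !inE => /andP[xY xX] /andP[yX yY].
have -> : (y |: (X :\ x)) :\: Y = (X :\: Y) :\ x by set_eq.
by rewrite (cardsD1 x (X :\: Y)) !inE xY xX.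
Qed.

Lemma setD_card1 (X Y : {set T}) x : B X -> B Y ->
  x \in X :\: Y -> (#|X :\: Y| <= 1)%N ->
  exists2 y, y \in Y :\: X & (y |: (X :\ x) = Y) /\ (x |: (Y :\ y) = X).
Proof.
move=> BX BY xXY c1.
have c1' : #|X :\: Y| == 1%N by rewrite eqn_leq c1 (cardsD1 x) xXY.
have /cards1P[y ey] : #|Y :\: X| == 1%N by rewrite -(card_setDC BX BY).
have /cards1P[x' ex] := c1'.
have xx' : x = x' by move: xXY; rewrite ex inE => /eqP.
rewrite -{}xx' in ex.
exists y; first by rewrite ey set11.
by split; apply/setP => z; move/setP/(_ z): ex; move/setP/(_ z): ey;
  rewrite !inE => <- <-; case: (z \in X); case: (z \in Y).
Qed.

(** Exchanging some [x1 != x] out of [X] brings [X] closer to [Y] and keeps [x]. The element found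
    for the new pair still works, since [x1] is not in [Y]. *)
Lemma exchange_dual X Y : B X -> B Y -> forall x, x \in X :\: Y ->
  exists2 y, y \in Y :\: X & B (x |: (Y :\ y)).
Proof.
have [m] := ubnP #|X :\: Y|; elim: m X => // m IH X ltm BX BY x xXY.
have [c1|c2] := leqP #|X :\: Y| 1.
  by have [y yYX [_ e]] := setD_card1 BX BY xXY c1; exists y; rewrite // e.
have [x1 x1XY] : exists x1, x1 \in (X :\: Y) :\ x.
  by apply/set0Pn; rewrite -card_gt0; move: c2; rewrite (cardsD1 x) xXY.
move: x1XY; rewrite in_setD1 => /andP[x1x x1XY].
have [y1 y1YX BX1] := exB BX BY x1XY.
have lt1 : (#|(y1 |: (X :\ x1)) :\: Y| < m)%N by rewrite card_swapD.
have xX1 : x \in (y1 |: (X :\ x1)) :\: Y.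
  by move: xXY; rewrite !inE => /andP[xY xX]; memb.
have [y yY By] := IH _ lt1 BX1 BY x xX1.
exists y => //.
move: yY x1XY; rewrite !inE negb_or negb_and negbK.
by case/andP=> /andP[_ /orP[/eqP->|->]] -> => [/andP[]|].
Qed.

Hypothesis locB : three_term.

(* Murota's argument: a counterexample [(X, Y)] with [#|X :\: Y| > 1] yields one
   closer to [X], by exchanging in [Y] an [x0 != x] against the [y0] that is cheapest
   after subtracting the potential [p], which makes the exchanges of [x]
   neutral at [X] and costly at [Y]. *)
Lemma three_term_valuated_exchange : valuated_exchange.
Proof.
move=> X Y BX; have [m] := ubnP #|X :\: Y|; elim: m Y => // m IH Y ltm BY x xXY.
have [c1|c2] := leqP #|X :\: Y| 1.
  have [y yYX [e1 e2]] := setD_card1 BX BY xXY c1.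
  by exists y => //; rewrite e1 e2; split=> //; rewrite addrC.
have [x0 x0XY] : exists x0, x0 \in (X :\: Y) :\ x.
  by apply/set0Pn; rewrite -card_gt0; move: c2; rewrite (cardsD1 x) xXY.
move: x0XY; rewrite in_setD1 => /andP[x0x x0XY].
pose good y := [&& y \in Y :\: X, B (y |: (X :\ x)), B (x |: (Y :\ y))
  & w (y |: (X :\ x)) + w (x |: (Y :\ y)) <= w X + w Y].
case: (pickP good) => [y /and4P[yYX By1 By2 le_y]|bad]; first by exists y.
(* Where the exchange at [X] is infinite, any value below [w (x |: (Y :\ v)) - w Y] would do;
   subtracting 1 makes [p_lt] strict. *)
pose p v := if B (v |: (X :\ x)) then w X - w (v |: (X :\ x))
            else w (x |: (Y :\ v)) - w Y - 1.
have p_lt v : v \in Y :\: X -> B (x |: (Y :\ v)) ->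
    w Y < w (x |: (Y :\ v)) - p v.
  rewrite /p => vYX BYv; have := bad v; rewrite /good vYX BYv /=.
  by case: ifP => //= _; [move/negbT; rewrite -ltNge; lra | lra].
have [y1 y1YX BY1] := exchange_dual BX BY x0XY.
have y1P : (y1 \in Y :\: X) && B (x0 |: (Y :\ y1)) by rewrite y1YX.
case: (arg_minP (fun v => w (x0 |: (Y :\ v)) - p v)
  (P := [pred v | (v \in Y :\: X) && B (x0 |: (Y :\ v))]) y1P).
move=> y0 /andP[y0YX BY0] y0min {y1 y1YX BY1 y1P}.
have [x0Y x0X] : x0 \notin Y /\ x0 \in X.
  by move: x0XY; rewrite inE => /andP[].
have [xY xX] : x \notin Y /\ x \in X by move: xXY; rewrite inE => /andP[].
have [y0X y0Y] : y0 \notin X /\ y0 \in Y by move: y0YX; rewrite inE => /andP[].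
set Y' := x0 |: (Y :\ y0) in BY0 *.
have ltY' : (#|X :\: Y'| < m)%N.
  rewrite -ltnS (card_setDC BX BY0) (leq_trans _ ltm) // ltnS (card_setDC BX BY).
  by rewrite -(card_swapD y0YX x0XY).
have xXY' : x \in X :\: Y' by rewrite !inE; memb.
have [y yYX' [By1 By2 le_y]] := IH Y' ltY' BY0 x xXY'.
have {yYX'} [y0y [yY yX]] : y != y0 /\ y \in Y /\ y \notin X.
  move: yYX'; rewrite !inE => /andP[yX]; case: eqP => [e|_ /=]; last by case/andP.
  by rewrite e x0X in yX.
have yYX : y \in Y :\: X by rewrite !inE yX.
pose I := Y :\ y0 :\ y.
have eY : y0 |: (y |: I) = Y by rewrite /I; set_eq.
have eZ : x |: (x0 |: I) = x |: (Y' :\ y) by rewrite /I /Y'; set_eq.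
have := @locB I y0 y x x0; rewrite /= eY eZ.
have -> : y0 |: (x |: I) = x |: (Y :\ y) by rewrite /I; set_eq.
have -> : y |: (x0 |: I) = Y' by rewrite /I /Y'; set_eq.
have -> : y0 |: (x0 |: I) = x0 |: (Y :\ y) by rewrite /I; set_eq.
have -> : y |: (x |: I) = x |: (Y :\ y0) by rewrite /I /Y'; set_eq.
have py : p y = w X - w (y |: (X :\ x)) by rewrite /p By1.
(* Local exchange between [Y] and [x |: (Y' :\ y)]. Added to [le_y], its first outcome contradicts
   [p_lt] at [y]; its second one, with the minimality of [y0], contradicts [p_lt] at [y0]. *)
case; rewrite ?inE; memb => -[B1 B2 le3]; exfalso.
  by have := p_lt y yYX B1; lra.
have := p_lt y0 y0YX B2; have := y0min y.
by rewrite /= yYX B1 -/Y' => /(_ isT); lra.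
Qed.
End ValuatedExchange.

(** * Quotients and transitivity *)

Section Quotient.
Variables (T : finType) (r : nat) (N M : pred {set T}).
Hypothesis cardN : forall A, N A -> #|A| = r.
Hypothesis cardM : forall A, M A -> #|A| = r.+1.
Hypothesis exN : exchange N.
Hypothesis exM : exchange M.
Hypothesis subNM : forall A, N A -> exists2 A', M A' & A \subset A'.
Hypothesis supNM : forall A', M A' -> exists2 A, N A & A \subset A'.
Hypothesis incNM : forall (I : {set T}) a b c, uniq [:: a; b; c] ->
  a \notin I -> b \notin I -> c \notin I ->
  N (a |: I) -> M (b |: (c |: I)) ->
  N (b |: I) /\ M (a |: (c |: I)) \/ N (c |: I) /\ M (a |: (b |: I)).

(** [A] extends to a base by one element [z]; if [z] is not in [Y], it is exchanged for an element
    of [Y]. This lemma and the next two are the mixed cases of the exchange axiom of the lift. *)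
Lemma quotient_augment A Y : N A -> M Y -> exists2 y, y \in Y :\: A & M (y |: A).
Proof.
move=> NA MY; have [A' MA' sAA'] := subNM NA.
have /cards1P[z ez] : #|A' :\: A| == 1%N.
  by rewrite cardsD (setIidPr sAA') (cardM MA') (cardN NA) subSnn.
have zA' : z \in A' :\: A by rewrite ez set11.
have eA' : A' = z |: A by rewrite -[LHS](setID A' A) ez (setIidPr sAA') setUC.
have [zY|zY] := boolP (z \in Y).
  by exists z; [move: zA'; rewrite !inE zY => /andP[->] | rewrite -eA'].
have [|y yYA' My] := exM MA' MY (x := z).
  by move: zA'; rewrite !inE zY => /andP[_].
have zA : z \notin A by move: zA'; rewrite inE => /andP[].
have e : A' :\ z = A by rewrite eA' setU1K.
exists y; last by rewrite -e.
by move: yYA'; rewrite eA' !inE negb_or => /andP[/andP[_ ->]].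
Qed.

Lemma quotient_replace A Y : N A -> M Y -> forall x, x \in A :\: Y ->
  exists2 y, y \in Y :\: A & N (y |: (A :\ x)).
Proof.
move=> NA MY x; rewrite inE => /andP[xY xA]; have [A' NA' sA'Y] := supNM MY.
have [|y] := exN NA NA' (x := x).
  by rewrite inE xA (contra (subsetP sA'Y x) xY).
by rewrite !inE => /andP[yA yA'] Ny; exists y; rewrite // inE yA (subsetP sA'Y).
Qed.

(* If no exchange brings an element of [A] into [X :\ x], then [A] lies in the
   hyperplane of [M] spanned by [X :\ x]; walking from [A] to [X :\ x] through
   bases of this hyperplane, each step stays in [N] by the incidence relation
   with the third element [x]. *)
Lemma quotient_exchange A X : N A -> M X -> forall x, x \in X :\: A ->
  N (X :\ x) \/ exists2 y, y \in A :\: X & M (y |: (X :\ x)).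
Proof.
move=> NA MX x xXA.
have [|noy] := boolP [exists y in A :\: X, M (y |: (X :\ x))].
  by case/exists_inP=> y yA My; right; exists y.
left; have {noy} noy y : y \in A -> y \notin X -> ~~ M (y |: (X :\ x)).
  move=> yA yX; apply: contra noy => My; apply/exists_inP.
  by exists y; rewrite ?inE ?yX.
have [m] := ubnP #|A :\: X|; elim: m A NA noy xXA => // m IH A NA noy xXA ltm.
have [xA xX] : x \notin A /\ x \in X by move: xXA; rewrite inE => /andP[].
(* Otherwise exchanging [x] out of [X] towards [z |: A] would bring in an element of [A], against
   [noy]. Hence only [x] can augment [A]. *)
have notM z : z \in X -> z != x -> ~~ M (z |: A).
  move=> zX zx; apply/negP=> Mz.
  have [|y yAX My] := exM MX Mz (x := x).
    by rewrite !inE xX andbT negb_or eq_sym zx.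
  move: yAX; rewrite !inE => /andP[yX /orP[/eqP yz|yA]]; first by rewrite yz zX in yX.
  by have := noy y yA yX; rewrite My.
have MxA : M (x |: A).
  have [z] := quotient_augment NA MX; rewrite inE => /andP[zA zX].
  by have [->//|zx] := eqVneq z x; rewrite (negbTE (notM z zX zx)).
have [e|[a aAX]] := set_0Vmem (A :\: X).
  suff -> : X :\ x = A by [].
  apply/esym/eqP; rewrite eqEcard (cardN NA); have := cardM MX.
  rewrite (cardsD1 x X) xX add1n => -[->]; rewrite leqnn andbT.
  apply/subsetP=> y yA; rewrite !inE.
  have [yx|_ /=] := eqVneq y x; first by rewrite -yx yA in xA.
  by move/setP/(_ y): e; rewrite !inE yA andbT => /negbFE.
have [aX aA] : a \notin X /\ a \in A by move: aAX; rewrite inE => /andP[].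
have [|b] := exM MxA MX (x := a); first by rewrite !inE aX aA orbT.
rewrite !inE negb_or => /andP[/andP[bx bA] bX] Mb.
have bXA : b \in X :\: A by rewrite inE bA.
pose I := A :\ a.
have ab : a != b by rewrite (mem_notin_neq aA bA).
have := @incNM I a b x.
have -> : a |: I = A by rewrite /I; set_eq.
have -> : b |: (x |: I) = b |: ((x |: A) :\ a).
  by have ax := mem_notin_neq aA xA; rewrite /I; set_eq; rewrite ?ax.
have -> : a |: (b |: I) = b |: A by rewrite /I; set_eq.
case; rewrite /I ?inE ?NA ?Mb; memb.
  by rewrite !negb_or ab bx (mem_notin_neq aA xA).
- move=> [NbA _]; apply: IH NbA _ _ _; rewrite -/I.
  + by move=> y; rewrite !inE => /orP[/eqP->|/andP[_]]; [rewrite bX | apply: noy].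
  + by rewrite !inE; memb; rewrite eq_sym (negbTE bx).
  + by rewrite -ltnS (card_swapD aAX bXA).
by case=> _; rewrite (negbTE (notM b bX bx)).
Qed.

End Quotient.

Section Pluecker.
Variables (T : finType) (R : realFieldType).
Variables (B : pred {set T}) (w : {set T} -> R).

Definition plucker_exchange (I J : {set T}) :=
  forall j, j \in J :\: I -> B (j |: I) -> B (J :\ j) ->
    exists2 j', j' \in (J :\: I) :\ j &
      dominates B w (j' |: I) (J :\ j') (j |: I) (J :\ j).

Lemma sum_swap (V : zmodType) (g : T -> V) (K : {set T}) x y :
  x \in K -> y \notin K ->
  \sum_(i in y |: (K :\ x)) g i = \sum_(i in K) g i - g x + g y.
Proof.
move=> xK yK; rewrite big_setU1 ?inE ?(negbTE yK) ?andbF //=.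
by rewrite (big_setD1 x xK) /= [g x + _]addrC addrK addrC.
Qed.

(* [y j := w (j |: I)] for [j] in [F], and [y j] infinite outside, is a vector of
   the tropical linear space of the [k]-sets. A base [K] containing [e] that
   avoids [F] as much as possible and then minimizes [w K - \sum_(j in K) y j]
   has a cocircuit [j |-> w (j |: (K :\ e))] that, once translated, bounds [y]
   from above with equality at [e]; this reduces the relation of [I] and [J] at
   [e] to the one of [K :\ e] and [J]. *)
Lemma plucker_exchange_trans k (I J : {set T}) :
  (exists2 K : {set T}, #|K| = k & B K) ->
  (forall J' : {set T}, #|J'| = k.+1 -> plucker_exchange I J') ->
  (forall I' : {set T}, #|I'|.+1 = k -> plucker_exchange I' J) ->
  plucker_exchange I J.
Proof.
move=> [K0 cK0 BK0] relI relJ e; rewrite inE => /andP[eI eJ] Be BJe.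
pose F := [set j | (j \notin I) && B (j |: I)].
pose y j := if j \in F then w (j |: I) else 0.
(* Minimizing [ht] first and [cost] second is minimizing [w K - \sum_(j in K) y j] with [y] infinite
   outside [F]: each element outside [F] beats any finite difference. *)
pose ht (K : {set T}) : int := \sum_(j in K) (j \in F)%:R.
pose cost (K : {set T}) := w K - \sum_(j in K) y j.
pose base (K : {set T}) := (#|K| == k) && B K.
have eF : e \in F by rewrite inE eI.
have [K [eK /andP[/eqP cK BK] minK]] : exists K : {set T}, [/\ e \in K, base K &
    forall K' : {set T}, base K' ->
      ht K <= ht K' /\ (ht K = ht K' -> cost K <= cost K')].
  have b0 : base K0 by rewrite /base cK0 eqxx.
  have [K1 b1 min1] := arg_minP ht b0.
  have b1' : base K1 && (ht K1 == ht K1) by rewrite b1 eqxx.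
  have [K2 /andP[b2 /eqP h2] min2] := arg_minP cost
    (P := fun K => base K && (ht K == ht K1)) b1'.
  have opt2 (K' : {set T}) : base K' ->
      ht K2 <= ht K' /\ (ht K2 = ht K' -> cost K2 <= cost K').
    move=> b'; rewrite h2; split=> [|e']; first exact: min1.
    by apply: min2; rewrite b' -e' eqxx.
  have [eK|eK] := boolP (e \in K2); first by exists K2.
  (* If the optimum misses [e], the relation of [I] and [e |: K2] at [e] gives a [j] in [F] to trade
     for [e]; this keeps [ht] and does not raise [cost]. *)
  have /andP[/eqP c2 B2] := b2.
  have := relI (e |: K2); rewrite cardsU1 eK c2 => /(_ erefl e).
  rewrite !inE eqxx eI setU1K // => /(_ isT Be B2)[j].
  rewrite !inE; have [//|je /=] := eqVneq j e => /andP[jI jK] [Bj BKj le_j].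
  have eKj : (e |: K2) :\ j = e |: (K2 :\ j) by set_eq.
  rewrite eKj in BKj le_j.
  have jF : j \in F by rewrite inE jI.
  exists (e |: (K2 :\ j)); split; first by rewrite !inE eqxx.
    rewrite /base BKj andbT cardsU1 !inE (negbTE eK) andbF add1n -c2.
    by rewrite (cardsD1 j K2) jK.
  move=> K' /opt2[le_ht le_cost]; split.
    by rewrite /ht sum_swap // eF jF subrK.
  rewrite {1}/ht sum_swap // eF jF subrK => /le_cost; apply: le_trans.
  by rewrite /cost sum_swap // /y eF jF; lra.
have [||||j] := relJ (K :\ e) _ e.
- by rewrite -cK (cardsD1 e K) eK.
- by rewrite !inE eqxx.
- by rewrite setD1K.
- by [].
rewrite !inE negb_and negbK setD1K // => /andP[je /andP[]].
rewrite (negbTE je) /= => jK jJ [BKj BJj le_j].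
(* A [j] outside [F] would lower [ht]. So [j] is in [F], and the optimality of [cost] bounds
   [w (j |: I) + w K] by [w (j |: (K :\ e)) + w (e |: I)]; adding [le_j] concludes. *)
have [|] := minK (j |: (K :\ e)).
  by rewrite /base BKj andbT cardsU1 !inE (negbTE jK) andbF add1n -cK (cardsD1 e K) eK.
rewrite /ht /cost !sum_swap // eF; have [jF _|jF] := boolP (j \in F); last first.
  by rewrite addr0 lerDl oppr_ge0 ler10 => -[].
rewrite subrK => /(_ erefl); rewrite /y eF jF => le_c.
have [jI Bj] : j \notin I /\ B (j |: I) by move: jF; rewrite inE => /andP[].
exists j; first by rewrite !inE je jI.
by split=> //; lra.
Qed.
End Pluecker.

(** * Two consecutive layers *)

Section OptionPreimage.
Variable T : finType.
Implicit Types (S : {set option T}) (A : {set T}).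

Lemma preimSomeU1 a S : Some @^-1: (Some a |: S) = a |: Some @^-1: S.
Proof. by apply/setP=> z; rewrite !inE. Qed.

Lemma preimSomeU1N S : Some @^-1: (None |: S) = Some @^-1: S.
Proof. by apply/setP=> z; rewrite !inE. Qed.

Lemma preimSomeD1 a S : Some @^-1: (S :\ Some a) = Some @^-1: S :\ a.
Proof. by apply/setP=> z; rewrite !inE. Qed.

Lemma preimSomeD1N S : Some @^-1: (S :\ None) = Some @^-1: S.
Proof. by apply/setP=> z; rewrite !inE. Qed.

Lemma preimSomeK A : Some @^-1: (Some @: A) = A.
Proof. by apply/setP=> z; rewrite inE mem_imset //; apply: Some_inj. Qed.

Lemma card_preimSome S : #|S| = ((None \in S) + #|Some @^-1: S|)%N.
Proof.
rewrite (cardsD1 None); suff -> : S :\ None = Some @: (Some @^-1: S).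
  by rewrite card_imset //; apply: Some_inj.
apply/setP=> -[z|]; rewrite !inE.
  by rewrite mem_imset ?inE //; apply: Some_inj.
by apply/esym/imsetP => -[].
Qed.
End OptionPreimage.

Definition preimSomeE := (preimSomeU1, preimSomeU1N, preimSomeD1, preimSomeD1N).

Lemma cardsU2 (T : finType) (I : {set T}) a b :
  a != b -> a \notin I -> b \notin I -> #|a |: (b |: I)| = #|I|.+2.
Proof. by move=> ab aI bI; rewrite !cardsU1 !inE negb_or ab aI bI. Qed.

Lemma cards3 (T : finType) (a b c : T) : uniq [:: a; b; c] -> #|[set a; b; c]| = 3.
Proof.
rewrite /= !inE andbT negb_or => /andP[/andP[ab ac] bc].
by rewrite -setUA cardsU1 !inE negb_or ab ac cards2 bc.
Qed.

Section ThreeTerm.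
Variables (T : finType) (R : realFieldType).
Variables (B : pred {set T}) (w : {set T} -> R).
Implicit Types A X Y : {set T}.

Definition of_card k : pred {set T} := fun A => (#|A| == k) && B A.

Lemma dominates_swapl X' Y' X Y :
  dominates B w X' Y' X Y -> dominates B w Y' X' X Y.
Proof. by case=> ? ? ?; split=> //; rewrite addrC. Qed.

Lemma dominates_swapr X' Y' X Y :
  dominates B w X' Y' X Y -> dominates B w X' Y' Y X.
Proof. by case=> ? ? ?; split=> //; rewrite [w Y + _]addrC. Qed.

Lemma of_card_dominates k X' Y' X Y : #|X'| = k -> #|Y'| = k ->
  dominates B w X' Y' X Y -> dominates (of_card k) w X' Y' X Y.
Proof. by move=> c c' [BX BY le]; split; rewrite /of_card ?BX ?BY ?c ?c' ?eqxx. Qed.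

(** The relation at [j] is the exchange of [j] between the bases [j |: I] and [J :\ j]. *)
Lemma valuated_plucker k : valuated_exchange (of_card k) w ->
  forall I J : {set T}, #|I|.+1 = k -> #|J| = k.+1 -> plucker_exchange B w I J.
Proof.
move=> vex I J cI cJ j; rewrite inE => /andP[jI jJ] BI BJ.
have BX : of_card k (j |: I) by rewrite /of_card BI cardsU1 jI -cI eqxx.
have BY : of_card k (J :\ j).
  by have := cardsD1 j J; rewrite jJ cJ add1n => -[ck]; rewrite /of_card BJ -ck eqxx.
have [|y] := vex _ _ BX BY j; first by rewrite !inE !eqxx.
rewrite !inE negb_or => /andP[/andP[yj yI] /andP[_ yJ]].
have -> : y |: ((j |: I) :\ j) = y |: I by set_eq.
have -> : j |: ((J :\ j) :\ y) = J :\ y by set_eq.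
case=> /andP[_ B1] /andP[_ B2] le; exists y; first by rewrite !inE yj yI.
by split.
Qed.

Hypothesis plucker3 : forall I J : {set T},
  (#|I|.+2 <= #|J|)%N -> #|J :\: I| = 3 -> plucker_exchange B w I J.

(** The case of [plucker3] where the smaller set lies in the larger one, here
    [J = a |: (b |: (c |: I))]. *)
Lemma three_term_incidence (I : {set T}) a b c :
  uniq [:: a; b; c] -> a \notin I -> b \notin I -> c \notin I ->
  B (a |: I) -> B (b |: (c |: I)) ->
  dominates B w (b |: I) (a |: (c |: I)) (a |: I) (b |: (c |: I)) \/
  dominates B w (c |: I) (a |: (b |: I)) (a |: I) (b |: (c |: I)).
Proof.
move=> u aI bI cI BI BJ; pose J := a |: (b |: (c |: I)).
have [/andP[ab ac] bc] : (a != b) && (a != c) /\ b != c.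
  by move: u; rewrite /= !inE negb_or andbT => /andP[].
have eD : J :\: I = [set a; b; c] by rewrite /J; set_eq.
have cJ : #|J| = #|I|.+3 by rewrite /J cardsU1 cardsU2 // !inE; memb.
have Ja : J :\ a = b |: (c |: I) by rewrite /J; set_eq.
have Jb : J :\ b = a |: (c |: I) by rewrite /J; set_eq.
have Jc : J :\ c = a |: (b |: I) by rewrite /J; set_eq.
have := @plucker3 I J _ _ a; rewrite eD cJ cards3 // !inE eqxx Ja.
case=> // j; rewrite !inE => /andP[/negbTE->] /= /orP[]/eqP->.
  by rewrite Jb; left.
by rewrite Jc; right.
Qed.

(** The other case of [plucker3], for two sets whose sizes differ by 2: [a] joins the smaller set,
    and [b], [c], [d] index the three terms. *)
Lemma three_term_plucker (I : {set T}) a b c d :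
  uniq [:: a; b; c; d] ->
  a \notin I -> b \notin I -> c \notin I -> d \notin I ->
  B (a |: (b |: I)) -> B (c |: (d |: I)) ->
  dominates B w (a |: (c |: I)) (b |: (d |: I)) (a |: (b |: I)) (c |: (d |: I)) \/
  dominates B w (a |: (d |: I)) (b |: (c |: I)) (a |: (b |: I)) (c |: (d |: I)).
Proof.
rewrite /= !inE !negb_or !andbT.
case/and3P=> /and3P[ab ac ad] /andP[bc bd] cd aI bI cI dI BI BJ.
pose I' := a |: I; pose J := b |: (c |: (d |: I)).
have eD : J :\: I' = [set b; c; d] by rewrite /J /I'; set_eq.
have cI' : #|I'| = #|I|.+1 by rewrite cardsU1 aI.
have cJ : #|J| = #|I|.+3 by rewrite /J cardsU1 cardsU2 // !inE; memb.
have Jb : J :\ b = c |: (d |: I) by rewrite /J; set_eq.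
have Jc : J :\ c = b |: (d |: I) by rewrite /J; set_eq.
have Jd : J :\ d = b |: (c |: I) by rewrite /J; set_eq.
have := @plucker3 I' J _ _ b; rewrite eD cJ cI' cards3 ?inE ?eqxx ?Jb; last first.
  by rewrite /= !inE negb_or bc bd cd.
rewrite /I' [b |: (a |: I)]setUCA; case=> // j; rewrite !inE.
case/andP=> /negbTE-> /= /orP[]/eqP->.
  by rewrite Jc [c |: (a |: I)]setUCA; left.
by rewrite Jd [d |: (a |: I)]setUCA; right.
Qed.

Lemma three_term_of_card k : three_term (of_card k) w.
Proof.
move=> I a b c d u aI bI cI dI X Y /andP[/eqP cX BX] /andP[/eqP cY BY].
have := three_term_plucker u aI bI cI dI BX BY.
move: u; rewrite /= !inE !negb_or !andbT.
case/and3P=> /and3P[ab ac ad] /andP[bc bd] cd.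
have cI2 : k = #|I|.+2 by rewrite -cX cardsU2.
by case=> dom; [left | right]; apply: of_card_dominates dom; rewrite cardsU2.
Qed.

Lemma plucker_of_exchange k : exchange (of_card k) ->
  forall I J : {set T}, #|I|.+1 = k -> #|J| = k.+1 -> plucker_exchange B w I J.
Proof.
move=> ex; apply: valuated_plucker.
apply: (@three_term_valuated_exchange _ _ _ _ k) ex _.
  by move=> X /andP[/eqP].
exact: three_term_of_card.
Qed.

Variable r : nat.
Hypothesis exN : exchange (of_card r).
Hypothesis exM : exchange (of_card r.+1).
Hypothesis subNM : forall A, of_card r A -> exists2 A', of_card r.+1 A' & A \subset A'.
Hypothesis supNM : forall A', of_card r.+1 A' -> exists2 A, of_card r A & A \subset A'.

(* The elementary lift: one extra element [None] such that the [r.+1]-sets are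
   the bases without it and the [r]-sets the bases with it. *)
Definition lift : pred {set option T} :=
  fun S => (#|S| == r.+1) && B (Some @^-1: S).

(** If [None] is not one of [a], [b], [c], [d], both preimages have the same size and this is a
    Plücker relation. Otherwise their sizes differ by one and it is an incidence relation, up to
    reordering. *)
Lemma three_term_lift : three_term lift (fun S => w (Some @^-1: S)).
Proof.
move=> I a b c d u aI bI cI dI X Y /andP[/eqP cX BX] /andP[/eqP cY BY].
suff : dominates B w (Some @^-1: (a |: (c |: I))) (Some @^-1: (b |: (d |: I)))
    (Some @^-1: X) (Some @^-1: Y) \/
  dominates B w (Some @^-1: (a |: (d |: I))) (Some @^-1: (b |: (c |: I)))
    (Some @^-1: X) (Some @^-1: Y).
  move: u; rewrite /= !inE !negb_or !andbT.
  case/and3P=> /and3P[ab ac ad] /andP[bc bd] cd.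
  have cI2 : r.+1 = #|I|.+2 by rewrite -cX cardsU2.
  by case=> -[B1 B2 le]; [left | right]; split; rewrite // /lift cardsU2 // cI2 eqxx.
have memI z : (Some z \notin I) = (z \notin Some @^-1: I) by rewrite inE.
have memS (z t : T) : (Some z == Some t) = (z == t) by [].
clear cX cY; move: u aI bI cI dI BX BY; rewrite {}/X {}/Y.
case: a b c d => [a|] [b|] [c|] [d|]; rewrite ?preimSomeE /= ?inE ?andbF ?memI //.
- by move=> u *; apply: three_term_plucker; rewrite /= ?inE ?memI.
- move=> u aI bI cI _ BI BJ.
  have u' : uniq [:: c; a; b].
    move: u; rewrite /= !inE !memS (eq_sym c a) (eq_sym c b).
    by case: (a == b) (a == c) (b == c) => -[] [].
  case: (three_term_incidence u' cI aI bI BJ BI) => /dominates_swapr dom.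
    by right; rewrite [b |: _]setUCA.
  by left; rewrite [a |: (c |: _)]setUCA; apply: dominates_swapl.
- move=> u aI bI _ dI BI BJ.
  have u' : uniq [:: d; a; b].
    move: u; rewrite /= !inE !memS (eq_sym d a) (eq_sym d b).
    by case: (a == b) (a == d) (b == d) => -[] [].
  case: (three_term_incidence u' dI aI bI BJ BI) => /dominates_swapr dom.
    by left; rewrite [b |: _]setUCA.
  by right; rewrite [a |: (d |: _)]setUCA; apply: dominates_swapl.
- move=> u aI _ cI dI BI BJ.
  have u' : uniq [:: a; c; d] by rewrite /= !inE -!memS.
  by case: (three_term_incidence u' aI cI dI BI BJ) => /dominates_swapl; [right|left].
- move=> u _ bI cI dI BI BJ.
  have u' : uniq [:: b; c; d] by rewrite /= !inE -!memS.
  exact: three_term_incidence.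
Qed.

(** Four cases, by whether [X] and [Y] contain [None]. If they agree, this is the exchange within
    one layer; if not, the quotient lemmas apply. In [quotient_exchange], the alternative
    [N (X :\ x)] means that [None] enters. *)
Lemma exchange_lift : exchange lift.
Proof.
have card_pre S : lift S -> (None \in S) = false -> of_card r.+1 (Some @^-1: S).
  by case/andP=> /eqP cS BS nS; rewrite /of_card BS andbT -cS card_preimSome nS.
have card_preN S : lift S -> None \in S -> of_card r (Some @^-1: S).
  case/andP=> /eqP cS BS nS; rewrite /of_card BS andbT -eqSS -cS.
  by rewrite (card_preimSome S) nS.
have card_swap (S : {set option T}) x y : lift S -> x \in S -> y \notin S ->
    lift (y |: (S :\ x)) = B (Some @^-1: (y |: (S :\ x))).
  case/andP=> /eqP cS _ xS yS.
  by rewrite /lift cardsU1 !inE (negbTE yS) andbF -cS (cardsD1 x S) xS eqxx.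
move=> X Y lX lY x; rewrite inE => /andP[xY xX].
suff [y yX [yY By]] : exists2 y, y \notin X & y \in Y /\ B (Some @^-1: (y |: (X :\ x))).
  by exists y; rewrite ?card_swap // inE yX.
have cN A : of_card r A -> #|A| = r by case/andP=> /eqP.
have cM A : of_card r.+1 A -> #|A| = r.+1 by case/andP=> /eqP.
have inc (I : {set T}) a b c : uniq [:: a; b; c] ->
    a \notin I -> b \notin I -> c \notin I ->
    of_card r (a |: I) -> of_card r.+1 (b |: (c |: I)) ->
    of_card r (b |: I) /\ of_card r.+1 (a |: (c |: I)) \/
    of_card r (c |: I) /\ of_card r.+1 (a |: (b |: I)).
  move=> u aI bI cI /andP[/eqP cI1 BI] /andP[/eqP cI2 BJ].
  have cr : r = #|I|.+1 by rewrite -cI1 cardsU1 aI.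
  have := three_term_incidence u aI bI cI BI BJ.
  move: u; rewrite /= !inE !negb_or andbT => /andP[/andP[ab ac] bc].
  by rewrite /of_card !cardsU2 // !cardsU1 bI cI -cr add1n -cr !eqxx;
    case=> -[-> -> _]; [left | right].
have memP (S : {set option T}) z : (z \in Some @^-1: S) = (Some z \in S) by rewrite inE.
have [nX|/negbTE nX] := boolP (None \in X); have [nY|/negbTE nY] := boolP (None \in Y).
- case: x xX xY => [a|]; last by rewrite nY.
  have NX := card_preN _ lX nX; have NY := card_preN _ lY nY.
  rewrite -!memP => aX aY; have [|y] := exN NX NY (x := a); first by rewrite inE aY.
  rewrite inE !memP => /andP[yX yY] /andP[_ By].
  by exists (Some y); rewrite // preimSomeU1 preimSomeD1.
- have NX := card_preN _ lX nX; have MY := card_pre _ lY nY.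
  case: x xX xY => [a|_ _].
    rewrite -!memP => aX aY.
    have [|y] := quotient_replace exN supNM NX MY (x := a); first by rewrite inE aY.
    rewrite inE !memP => /andP[yX yY] /andP[_ By].
    by exists (Some y); rewrite // preimSomeU1 preimSomeD1.
  have [y] := quotient_augment cN cM exM subNM NX MY.
  rewrite inE !memP => /andP[yX yY] /andP[_ By].
  by exists (Some y); rewrite // preimSomeU1 preimSomeD1N.
- case: x xX xY => [a|]; last by rewrite nX.
  have MX := card_pre _ lX nX; have NY := card_preN _ lY nY.
  rewrite -!memP => aX aY.
  have [||[y]] := quotient_exchange cN cM exM subNM inc NY MX (x := a).
  + by rewrite inE aY.
  + case/andP=> _ Ba; exists None; rewrite ?nX ?nY //.
    by rewrite preimSomeU1N preimSomeD1.
  rewrite inE !memP => /andP[yX yY] /andP[_ By].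
  by exists (Some y); rewrite // preimSomeU1 preimSomeD1.
- case: x xX xY => [a|]; last by rewrite nX.
  have MX := card_pre _ lX nX; have MY := card_pre _ lY nY.
  rewrite -!memP => aX aY; have [|y] := exM MX MY (x := a); first by rewrite inE aY.
  rewrite inE !memP => /andP[yX yY] /andP[_ By].
  by exists (Some y); rewrite // preimSomeU1 preimSomeD1.
Qed.

Lemma plucker_incidence (I J : {set T}) : #|I|.+1 = r -> #|J| = r.+2 ->
  plucker_exchange B w I J.
Proof.
move=> cI cJ j; rewrite inE => /andP[jI jJ] BI BJ.
have vex := three_term_valuated_exchange
  (fun S => fun h : lift S => eqP (proj1 (andP h))) exchange_lift three_term_lift.
(* Adding [None] to [j |: I] makes both sets bases of the lift. The exchanged element comes from
   [Y], so it is not [None] and the exchange descends to [T]. *)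
pose X := None |: (Some j |: Some @: I); pose Y := Some @: (J :\ j).
have NS (A : {set T}) : (None \in Some @: A) = false by apply/imsetP => -[].
have SS (A : {set T}) a : (Some a \in Some @: A) = (a \in A).
  by rewrite mem_imset //; apply: Some_inj.
have lX : lift X.
  rewrite /lift /X !preimSomeE preimSomeK BI andbT !cardsU1 !inE NS SS (negbTE jI).
  by rewrite card_imset -?cI ?eqxx //; apply: Some_inj.
have lY : lift Y.
  rewrite /lift /Y preimSomeK BJ andbT card_imset; last exact: Some_inj.
  by have := cardsD1 j J; rewrite jJ cJ add1n => -[ck]; rewrite -ck eqxx.
have [|[y|]] := vex X Y lX lY (Some j).
- by rewrite /X /Y !inE SS !inE !eqxx.
- rewrite /X /Y !inE !SS !inE /= negb_or => /andP[/andP[yj yI] /andP[_ yJ]].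
  case=> /andP[_ B1] /andP[_ B2].
  rewrite !preimSomeE !preimSomeK in B1 B2 *.
  have {}yj : y != j by [].
  have e1 : y |: ((j |: I) :\ j) = y |: I by set_eq.
  have e2 : j |: ((J :\ j) :\ y) = J :\ y by set_eq.
  by rewrite {}e1 {}e2 in B1 B2 * => le; exists y; rewrite // !inE yj yI.
- by rewrite /X /Y !inE NS.
Qed.

End ThreeTerm.

(** * Exchange properties of flags *)

Section FlagMatroid.
Variables (T : finType) (R : realFieldType).
Variables (B : pred {set T}) (w : {set T} -> R).
Implicit Types I J X Y : {set T}.

Lemma plucker_exchange_flag :
  (forall I J, (#|I|.+2 <= #|J|)%N -> #|J :\: I| = 3 -> plucker_exchange B w I J) ->
  (forall k, (0 < k < #|T|)%N ->
     (exists X, of_card B k X) /\ exchange (of_card B k)) ->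
  (forall k, (0 < k)%N -> (k.+1 < #|T|)%N ->
     (forall X, of_card B k X -> exists2 Y, of_card B k.+1 Y & X \subset Y) /\
     (forall Y, of_card B k.+1 Y -> exists2 X, of_card B k X & X \subset Y)) ->
  forall I J, (#|I|.+2 <= #|J|)%N -> plucker_exchange B w I J.
Proof.
move=> three ex flag.
have inc I J : #|J| = #|I|.+3 -> plucker_exchange B w I J.
  move=> cJ; have := max_card J; rewrite cJ => ltI.
  have [_ ex1] := ex #|I|.+1 (ltnW ltI); have [_ ex2] := ex #|I|.+2 ltI.
  have [sub sup] := flag #|I|.+1 isT ltI.
  exact: (plucker_incidence three ex1 ex2 sub sup).
move=> I J le_IJ; have [d cJ] : exists d, #|J| = (#|I|.+2 + d)%N.
  by exists (#|J| - #|I|.+2)%N; rewrite subnKC.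
elim: d J cJ {le_IJ} => [|[|d] IH] J; last first.
- move=> cJ; have ltJ := max_card J.
  have [|[K /andP[/eqP cK BK]] _] := ex (#|I|.+2 + d)%N.
    by rewrite (leq_trans _ ltJ) ?andbT ?cJ; lia.
  (* The intermediate layer lies two below [J]: from [I] to it the induction hypothesis applies, and
     from it to [J] the gap is that of [inc]. *)
  apply: (@plucker_exchange_trans _ _ _ _ (#|I|.+2 + d)%N); first by exists K.
    by move=> J1 cJ1; apply: IH; rewrite cJ1 addnS.
  by move=> I1 cI1; apply: inc; rewrite cJ !addnS -cI1.
- by rewrite addn1; apply: inc.
rewrite addn0 => cJ; have [|_ ex1] := ex #|I|.+1; first by rewrite -cJ max_card.
exact: plucker_of_exchange three _ ex1 _ _ _ _.
Qed.

Hypothesis plucker : forall I J, (#|I|.+2 <= #|J|)%N -> plucker_exchange B w I J.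

(** This is the relation of [X :\ x] and [x |: Y] at [x], whose term there is [w X + w Y]. The bound
    on sizes makes this pair an admissible index. *)
Lemma plucker_swap X Y x : B X -> B Y -> (#|X| <= #|Y|)%N -> x \in X :\: Y ->
  exists2 y, y \in Y :\: X & B (y |: (X :\ x)) /\ B (x |: (Y :\ y)).
Proof.
move=> BX BY leXY; rewrite inE => /andP[xY xX].
have [||||y] := @plucker (X :\ x) (x |: Y) _ x.
- by rewrite cardsU1 xY add1n ltnS; move: leXY; rewrite (cardsD1 x X) xX.
- by rewrite !inE !eqxx.
- by rewrite setD1K.
- by rewrite setU1K.
rewrite !inE negb_and negbK => /and3P[yx yX yY] [B1 B2 _]; exists y.
  by move: yX yY; rewrite inE (negbTE yx) /= => -> ->.
have <- : (x |: Y) :\ y = x |: (Y :\ y) by have xy := yx; set_eq.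
by [].
Qed.

Lemma plucker_matroid k : exchange (of_card B k).
Proof.
move=> X Y /andP[/eqP cX BX] /andP[/eqP cY BY] x xXY.
have [|y yYX [By _]] := plucker_swap BX BY _ xXY; first by rewrite cX cY.
exists y => //; move: xXY yYX; rewrite /of_card By andbT !inE.
move=> /andP[_ xX] /andP[yX _].
by rewrite cardsU1 !inE (negbTE yX) andbF -cX (cardsD1 x X) xX.
Qed.

(** [X] stays fixed while swaps move elements of [X] into [Y]; [plucker_sub] fixes [Y] instead. *)
Lemma plucker_sup j k X : (j <= k)%N -> (exists Y, of_card B k Y) ->
  of_card B j X -> exists2 Y, of_card B k Y & X \subset Y.
Proof.
move=> jk [Y bY] /andP[/eqP cX BX].
have [m] := ubnP #|X :\: Y|; elim: m Y bY => // m IH Y bY ltm.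
have [e|[x xXY]] := set_0Vmem (X :\: Y).
  by exists Y; rewrite // -setD_eq0 e.
have /andP[/eqP cY BY] := bY.
have [|y yYX [_ By]] := plucker_swap BX BY _ xXY; first by rewrite cX cY.
move: xXY yYX; rewrite !inE => /andP[xY xX] /andP[yX yY].
apply: (IH (x |: (Y :\ y))).
  by rewrite /of_card By andbT cardsU1 !inE (negbTE xY) andbF -cY (cardsD1 y Y) yY.
have -> : X :\: (x |: (Y :\ y)) = (X :\: Y) :\ x by set_eq.
by move: ltm; rewrite (cardsD1 x (X :\: Y)) !inE xY xX.
Qed.

Lemma plucker_sub j k Y : (j <= k)%N -> (exists X, of_card B j X) ->
  of_card B k Y -> exists2 X, of_card B j X & X \subset Y.
Proof.
move=> jk [X bX] /andP[/eqP cY BY].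
have [m] := ubnP #|X :\: Y|; elim: m X bX => // m IH X bX ltm.
have [e|[x xXY]] := set_0Vmem (X :\: Y).
  by exists X; rewrite // -setD_eq0 e.
have /andP[/eqP cX BX] := bX.
have [|y yYX [By _]] := plucker_swap BX BY _ xXY; first by rewrite cX cY.
apply: (IH (y |: (X :\ x))); last by rewrite -ltnS (card_swapD xXY yYX).
move: xXY yYX; rewrite !inE => /andP[xY xX] /andP[yX yY].
by rewrite /of_card By andbT cardsU1 !inE (negbTE yX) andbF -cX (cardsD1 x X) xX.
Qed.
End FlagMatroid.

(** * Incidence-Pluecker polynomials *)

Section IncidencePlucker.
Variables (R : realType) (n : nat) (P : {set 'I_n} -> trop R).
Implicit Types I J : {set 'I_n}.

Definition finite_at : pred {set 'I_n} := fun A => P A != None.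
Definition weight A : R := odflt 0 (P A).

Definition ip_mon I J (j : 'I_n) : 'X_{1..nvars n} :=
  (U_(enum_rank (j |: I)) + U_(enum_rank (J :\ j)))%MM.

Lemma ip_monE I J j A :
  ip_mon I J j (enum_rank A) = ((j |: I == A) + (J :\ j == A))%N.
Proof. by rewrite mnmDE !mnm1E !(inj_eq enum_rank_inj). Qed.

(** Two indices can share a monomial only with its factors interchanged, and then [J :\: I] is
    contained in [[set j; j']]. So from three terms on nothing merges or cancels. *)
Lemma ip_mon_inj I J : (2 < #|J :\: I|)%N -> {in J :\: I &, injective (ip_mon I J)}.
Proof.
move=> c3 j j'; rewrite !inE => /andP[jI jJ] /andP[j'I j'J] e.
have := congr1 (fun m : 'X_{1..nvars n} => m (enum_rank (j |: I))) e.
rewrite !ip_monE eqxx.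
have [/setP/(_ j)|_] := eqVneq (j' |: I) (j |: I).
  by rewrite !inE eqxx (negbTE jI) orbF => /eqP.
have [/setP eJ _|//] := eqVneq (J :\ j') (j |: I).
suff : (#|J :\: I| <= 2)%N by rewrite leqNgt c3.
apply: leq_trans (_ : #|[set j; j']| <= 2)%N; last by rewrite cards2; case: (_ != _).
apply/subset_leq_card/subsetP=> z; rewrite !inE => /andP[zI zJ].
by move: (eJ z); rewrite !inE zJ (negbTE zI) andbT orbF => <-; case: (z == j').
Qed.

Lemma ip_rel_coeff I J m :
  (ip_rel R I J)@_m = \sum_(j in J :\: I) ip_sign R j I J * (ip_mon I J j == m)%:R.
Proof.
rewrite /ip_rel raddf_sum; apply: eq_bigr => j _ /=.
by rewrite mcoeffZ /PX -mpolyXD mcoeffX.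
Qed.

Lemma ip_sign_neq0 I J j : ip_sign R j I J != 0.
Proof. by rewrite signr_eq0. Qed.

Lemma ip_rel_support I J m : (2 < #|J :\: I|)%N ->
  reflect (exists2 j, j \in J :\: I & m = ip_mon I J j) (m \in msupp (ip_rel R I J)).
Proof.
move=> c3; rewrite mcoeff_msupp ip_rel_coeff; apply: (iffP idP) => [|[j jD ->]].
  have [/exists_inP[j jD /eqP->]|no] := boolP [exists j in J :\: I, m == ip_mon I J j].
    by exists j.
  rewrite big1 ?eqxx // => j jD; case: eqP => [e|_]; last by rewrite mulr0.
  by case/exists_inP: no; exists j; rewrite ?e.
rewrite (bigD1 j) //= eqxx mulr1 big1 ?addr0 ?ip_sign_neq0 // => j' /andP[j'D ne].
case: eqP => [/(ip_mon_inj c3 j'D jD) e|_]; last by rewrite mulr0.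
by rewrite e eqxx in ne.
Qed.

Lemma ip_mon_val I J j : mono_val (ip_mon I J j) (pt_val P) =
  if finite_at (j |: I) && finite_at (J :\ j)
  then Some (weight (j |: I) + weight (J :\ j)) else None.
Proof.
rewrite /mono_val; case: existsP => [[i /andP[]]|no].
  rewrite -[i]enum_valK ip_monE /pt_val enum_rankK /finite_at.
  by do 2![case: eqP => [->|_ //]]; move=> _ /eqP->; rewrite ?andbF.
rewrite ifT; last first.
  by apply/andP; split; apply/negP=> Pj; case: no;
    [exists (enum_rank (j |: I)) | exists (enum_rank (J :\ j))];
    rewrite ip_monE eqxx /pt_val enum_rankK Pj ?addnS.
congr Some; rewrite (eq_bigr (fun i =>
    (enum_rank (j |: I) == i)%:R * weight (enum_val i) +
    (enum_rank (J :\ j) == i)%:R * weight (enum_val i))); last first.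
  by move=> i _; rewrite mnmDE !mnm1E natrD mulrDl.
have pick A : \sum_(i < nvars n) (enum_rank A == i)%:R * weight (enum_val i) = weight A.
  rewrite (bigD1 (enum_rank A)) //= eqxx mul1r enum_rankK big1 ?addr0 // => i iA.
  by rewrite eq_sym (negbTE iA) mul0r.
by rewrite big_split /= !pick.
Qed.

(** Here [J] is [I] plus two elements [a] and [b]. Both terms have the same monomial and opposite
    signs, and the exchange merely interchanges [a] and [b]. *)
Lemma ip_rel_eq0 I J : (#|I|.+2 <= #|J|)%N -> (#|J :\: I| <= 2)%N ->
  ip_rel R I J = 0 /\ plucker_exchange finite_at weight I J.
Proof.
move=> leIJ c2; have cDI := cardsID I J.
have sIJ : I \subset J.
  apply/setIidPl/eqP; rewrite eqEcard subsetIl setIC.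
  by rewrite -(leq_add2r #|J :\: I|) cDI (leq_trans _ leIJ) // -addn2 leq_add2l.
have : #|J :\: I| == 2.
  rewrite eqn_leq c2 -(leq_add2l #|I|) addn2; apply: leq_trans leIJ _.
  by rewrite -cDI (setIidPr sIJ).
case/cards2P=> a [b [ab eD]].
wlog lt_ab : a b ab eD / (a < b)%N.
  move=> gen; have [lt|lt|e] := ltngtP a b; first exact: (gen a b).
    by apply: (gen b a); rewrite 1?eq_sym // eD setUC.
  by case/eqP: ab; apply: val_inj.
have mem z : (z \in [set a; b]) = (z \notin I) && (z \in J) by rewrite -eD inE.
have [aI aJ] : a \notin I /\ a \in J by apply/andP; rewrite -mem !inE eqxx.
have [bI bJ] : b \notin I /\ b \in J by apply/andP; rewrite -mem !inE eqxx orbT.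
have eJ : J = a |: (b |: I).
  by rewrite setUA -eD setUC -{1}(setIidPr sIJ) setID.
have Ja : J :\ a = b |: I by rewrite eJ; set_eq.
have Jb : J :\ b = a |: I by rewrite eJ; set_eq.
split; last first.
  move=> j; rewrite eD !inE => /orP[]/eqP-> B1 B2.
    exists b; first by rewrite !inE eq_sym ab eqxx orbT.
    by rewrite Ja Jb in B2 *; split; rewrite // addrC.
  exists a; first by rewrite !inE ab eqxx.
  by rewrite Ja Jb in B2 *; split; rewrite // addrC.
(* The sign exponent of [a] is thus [#|I|]; that of [b] is one more, as [a] is an element of [J]
   below [b]. *)
have countI x : x \notin I ->
    (#|[set i in I | (i < x)%N]| + #|[set i in I | (x < i)%N]| = #|I|)%N.
  move=> xI; rewrite -(cardsID [set i : 'I_n | (i < x)%N] I).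
  have -> : [set i in I | (i < x)%N] = I :&: [set i : 'I_n | (i < x)%N].
    by apply/setP=> z; rewrite !inE.
  have -> : [set i in I | (x < i)%N] = I :\: [set i : 'I_n | (i < x)%N].
    apply/setP=> z; rewrite !inE -leqNgt andbC ltn_neqAle.
    have [<-|ne] := eqVneq x z; first by rewrite (negbTE xI) !andbF.
    by rewrite -val_eqE in ne; rewrite ne.
  by [].
rewrite /ip_rel eD big_setU1 ?inE //= big_set1 Ja Jb [PX R (b |: I) * _]mulrC -scalerDl.
rewrite /ip_sign.
have -> : [set k in J | (k < a)%N] = [set i in I | (i < a)%N].
  apply/setP=> z; rewrite eJ !inE; case: (eqVneq z a) => [->|_].
    by rewrite ltnn !andbF.
  by case: (eqVneq z b) => [->|//]; rewrite ltnNge (ltnW lt_ab) !andbF.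
have -> : [set k in J | (k < b)%N] = a |: [set i in I | (i < b)%N].
  apply/setP=> z; rewrite eJ !inE; case: (eqVneq z a) => [->|_]; first by rewrite lt_ab.
  by case: (eqVneq z b) => [->|//]; rewrite ltnn !andbF.
by rewrite cardsU1 inE (negbTE aI) /= -addnA !countI // exprS mulN1r subrr scale0r.
Qed.

Lemma trop_sol_ip_rel I J : (#|I|.+2 <= #|J|)%N ->
  trop_sol (ip_rel R I J) (pt_val P) <-> plucker_exchange finite_at weight I J.
Proof.
move=> leIJ; have [c2|c3] := leqP #|J :\: I| 2.
  by have [e ex] := ip_rel_eq0 leIJ c2; split=> // _; left.
have suppP m := ip_rel_support m c3.
split.
  case=> [e0|[b1 [b2 [/suppP[j1 j1D ->] /suppP[j2 j2D ->] ne min]]]].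
    have /card_gt0P[j jD] : (0 < #|J :\: I|)%N by apply: leq_trans c3.
    have : ip_mon I J j \in msupp (ip_rel R I J) by apply/suppP; exists j.
    by rewrite e0 msupp0.
  move=> j jD Bj BJ.
  have [j' j'D lej] : exists2 j', j' \in (J :\: I) :\ j &
      tle (mono_val (ip_mon I J j') (pt_val P)) (mono_val (ip_mon I J j) (pt_val P)).
    have /andP[le1 le2] : _ && _ := min _ (introT (suppP _) (ex_intro2 _ _ j jD erefl)).
    (* At least one of the two minimizers differs from [j]. *)
    have [e|ne1] := eqVneq j1 j; last by exists j1; rewrite // in_setD1 ne1.
    exists j2; rewrite // in_setD1 j2D andbT; apply: contraNneq ne => ->.
    by rewrite e.
  exists j' => //; move: lej; rewrite !ip_mon_val Bj BJ /=.
  by case: ifP => //= /andP[? ?] ?; split.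
move=> ex; right.
have two j : j \in J :\: I -> exists2 j', j' \in J :\: I & j' != j.
  move=> jD; have /card_gt0P[j'] : (0 < #|(J :\: I) :\ j|)%N.
    by move: c3; rewrite (cardsD1 j) jD; case: #|_|.
  by rewrite in_setD1 => /andP[ne j'D]; exists j'.
pose fin j := (j \in J :\: I) && (finite_at (j |: I) && finite_at (J :\ j)).
pose wt j := weight (j |: I) + weight (J :\ j).
have [j0 fin0|none] := pickP fin.
  (* Exchanging at a minimal finite term yields a second term that is no larger, hence also
     minimal. *)
  have [j /andP[jD /andP[Bj BJ]] jmin] := arg_minP wt fin0.
  have [j'] := ex j jD Bj BJ; rewrite in_setD1 => /andP[ne j'D] [Bj' BJ' le].
  exists (ip_mon I J j), (ip_mon I J j'); split.
  - by apply/suppP; exists j.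
  - by apply/suppP; exists j'.
  - by apply: contraNneq ne => /(ip_mon_inj c3 jD j'D)->.
  move=> b /suppP[i iD ->]; rewrite !ip_mon_val Bj BJ Bj' BJ' /=.
  case: ifP => //= fi; have := jmin i; rewrite /fin iD fi => /(_ isT) lei.
  by rewrite lei (le_trans le lei).
(* All terms are infinite, so any two distinct monomials attain the minimum. *)
have /card_gt0P[j jD] : (0 < #|J :\: I|)%N by apply: leq_trans c3.
have [j' j'D ne] := two j jD.
exists (ip_mon I J j), (ip_mon I J j'); split.
- by apply/suppP; exists j.
- by apply/suppP; exists j'.
- by apply: contraNneq ne => /(ip_mon_inj c3 jD j'D)->.
move=> b /suppP[i iD ->]; rewrite !ip_mon_val.
have val0 k : k \in J :\: I -> finite_at (k |: I) && finite_at (J :\ k) = false.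
  by move=> kD; have := none k; rewrite /fin kD.
by rewrite !val0.
Qed.

Lemma ip_indexP I J : ip_index I J <-> (#|I|.+2 <= #|J|)%N.
Proof.
split=> [[r [s [r1 rs sn -> ->]]]|le]; first by rewrite prednK.
have := max_card J; rewrite card_ord => Jn.
have J0 : (0 < #|J|)%N by apply: leq_trans le.
exists #|I|.+1, #|J|.-1; split=> //; last by rewrite prednK.
  by rewrite -ltnS prednK.
exact: leq_trans (leq_pred _) Jn.
Qed.

Lemma in_supp_k k A : (A \in supp_k P k) = of_card finite_at k A.
Proof. by rewrite inE. Qed.
End IncidencePlucker.

Theorem theorem4 (R : realType) (n : nat) (hn : (2 <= n)%N)
    (P : {set 'I_n} -> trop R) :
  in_flag_tproj P ->
  (in_FlDr P <-> in_FlDr3M P).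
Proof.
move=> proj.
(* Being a projective point supplies a base in every layer. *)
have nonempty k : (0 < k < n)%N -> exists A, of_card (finite_at P) k A.
  move=> /andP[k0 kn]; have [|A [cA PA]] := proj k; first by rewrite k0; lia.
  by exists A; rewrite /of_card cA eqxx; apply/eqP.
have FlDrP : in_FlDr P <-> forall I J : {set 'I_n}, (#|I|.+2 <= #|J|)%N ->
    plucker_exchange (finite_at P) (weight P) I J.
  split=> h I J; first by move=> le; apply/trop_sol_ip_rel => //; apply/h/ip_indexP.
  by move=> /ip_indexP le; apply/trop_sol_ip_rel => //; apply: h.
split.
  move=> F; have /FlDrP ex := F; split; first by move=> I J ij _; apply: F.
  split.
    move=> k k1n; split; last by move=> A; rewrite in_supp_k => /andP[/eqP].
    have [|A bA] := nonempty k; first lia.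
    split; first by apply/set0Pn; exists A; rewrite in_supp_k.
    move=> B1 B2; rewrite !in_supp_k => b1 b2 x xB.
    have [y yB by_] := plucker_matroid ex b1 b2 xB.
    by exists y; rewrite ?in_supp_k.
  move=> j k j1 jk kn; split=> A; rewrite in_supp_k => bA.
    have [|A' bA' sA] := plucker_sup ex (ltnW jk) _ bA; first by apply: nonempty; lia.
    by exists A'; rewrite ?in_supp_k.
  have [|A' bA' sA] := plucker_sub ex (ltnW jk) _ bA; first by apply: nonempty; lia.
  by exists A'; rewrite ?in_supp_k.
move=> [F3 [mat flag]]; apply/FlDrP; apply: plucker_exchange_flag.
- move=> I J le c3; apply/trop_sol_ip_rel => //; apply: F3 => //.
  exact/ip_indexP.
- move=> k; rewrite card_ord => kn; split; first exact: nonempty.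
  have [|[_ ex] _] := mat k; first lia.
  move=> X Y; rewrite -!in_supp_k => bX bY x /(ex X Y bX bY)[y yYX by_].
  by exists y; rewrite -?in_supp_k.
move=> k k0; rewrite card_ord => kn; have [|||sub sup] := flag k k.+1; try lia.
split=> A; rewrite -in_supp_k; [move/sub | move/sup] => -[A' bA' sA];
  by exists A'; rewrite -?in_supp_k.
Qed.
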